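(* Let $G$ be a simply connected complex almost Abelian Lie group with Lie algebra $\mathfrak{a}(\aleph)$. Then every discrete normal subgroup $N\subseteq G$ is a free Abelian group of rank $$k\le \dim_{\mathbb{R}}\big(\ker J(\aleph)\big)+2,$$ generated by $k$ $\mathbb{R}$-linearly independent elements $[v_1,t_1],\dots,[v_k,t_k]\in Z(G)\subseteq G=\mathbb{C}^d\rtimes\mathbb{C}$.
   Context: A finitely-supported multiplicity function is a function $\aleph:\mathbb{C}\times\mathbb{N}\to\{0,1,2,\dots\}$ (with $\mathbb{N}=\{1,2,\dots\}$) that is nonzero at only finitely many pairs. Its Jordan matrix $J(\aleph)$ is the $d\times d$ block-diagonal matrix containing, for each $(\lambda,n)$, exactly $\aleph(\lambda,n)$ copies of the $n\times n$ Jordan block with eigenvalue $\lambda$. The Lie algebra $\mathfrak{a}(\aleph)$ is $\mathbb{C}^d\oplus\mathbb{C}$ with bracket $[(v,t),(u,s)] = (tJ(\aleph)u-sJ(\aleph)v,0)$; it is almost Abelian (non-Abelian with a codimension 1 Abelian subalgebra), so $J(\aleph)\neq 0$. The simply connected group is $G=\mathbb{C}^d\rtimes\mathbb{C}$ with elements $[v,t]$ and product $[v,t][u,s]=[v+e^{tJ(\aleph)}u,\,t+s]$. Linear independence of elements $[v_i,t_i]$ over $\mathbb{R}$ refers to the vectors $(v_i,t_i)\in\mathbb{C}^{d+1}$. $Z(G)$ is the center of $G$. *)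

(* Defs.v *)
From HB Require Import structures.
From mathcomp Require Import all_boot all_order all_algebra finmap complex.
From mathcomp Require Import all_classical all_reals all_analysis.

Set Implicit Arguments.
Unset Strict Implicit.
Unset Printing Implicit Defensive.

Import Order.TTheory GRing.Theory Num.Theory.
Import numFieldNormedType.Exports.

Local Open Scope classical_set_scope.
Local Open Scope ring_scope.
Local Open Scope complex_scope.

(* The usual metric topology on the complex plane: as for the abstract number
   structures in [numFieldNormedType], it is the one of [R[i]^o]. *)
Section ComplexTopology.
Variable R : realType.

#[non_forgetful_inheritance]
HB.instance Definition _ := GRing.ComAlgebra.copy R[i] R[i]^o.
#[non_forgetful_inheritance]
HB.instance Definition _ := Vector.copy R[i] R[i]^o.
#[non_forgetful_inheritance]
HB.instance Definition _ := NormedModule.copy R[i] R[i]^o.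

End ComplexTopology.

(* [Rcomplex R] is the complex plane seen as a vector space over [R]; making
   it a [vectType] gives access to [free] and [\dim] over the reals. *)
Section RcomplexVector.
Variable R : rcfType.

Fact Rcomplex_vect_iso : Vector.axiom 2 (Rcomplex R).
Proof.
exists (fun z : Rcomplex R => \row_(i < 2) (if i == 0 then complex.Re z else complex.Im z : R)).
  move=> a u v; apply/rowP => i; rewrite !mxE.
  by case: ifP; rewrite linearP.
exists (fun x : 'rV[R]_2 => (x 0 0 +i* x 0 1 : Rcomplex R)).
  by case=> a b; rewrite !mxE.
move=> x; apply/rowP => i; rewrite !mxE.
by case: i => -[|[|//]] Hi /=; congr (x _ _); apply/val_inj.
Qed.

HB.instance Definition _ :=
  Lmodule_hasFinDim.Build R (Rcomplex R) Rcomplex_vect_iso.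

End RcomplexVector.

Section Realification.
Variables (R : rcfType) (d : nat).

Definition realify (v : 'cV[R[i]]_d) : {ffun 'I_d -> Rcomplex R} :=
  [ffun j => v j 0].

Definition unrealify (w : {ffun 'I_d -> Rcomplex R}) : 'cV[R[i]]_d :=
  \col_j (w j : R[i]).

Definition real_mulmx (A : 'M[R[i]]_d) (w : {ffun 'I_d -> Rcomplex R}) :
    {ffun 'I_d -> Rcomplex R} :=
  realify (A *m unrealify w).

Fact real_mulmx_is_linear A : linear (real_mulmx A).
Proof.
have scaleE (a : R) (z : R[i]) : a *: (z : Rcomplex R) = a%:C * z :> R[i].
  by case: z => x y; apply/eqP; rewrite eq_complex /= !mul0r subr0 addr0 !eqxx.
move=> a u v; apply/ffunP => j; rewrite !ffunE !mxE /= scaleE.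
rewrite mulr_sumr -big_split /=; apply: eq_bigr => l _.
by rewrite !mxE !ffunE scaleE mulrDr !mulrA [A j l * _]mulrC.
Qed.

HB.instance Definition _ A :=
  GRing.isLinear.Build R {ffun 'I_d -> Rcomplex R} {ffun 'I_d -> Rcomplex R}
    _ (real_mulmx A) (real_mulmx_is_linear A).

Definition real_ker (A : 'M[R[i]]_d) : {vspace {ffun 'I_d -> Rcomplex R}} :=
  lker (linfun (real_mulmx A)).

Lemma mem_real_ker A (v : 'cV[R[i]]_d) :
  (realify v \in real_ker A) = (A *m v == 0).
Proof.
have vK : unrealify (realify v) = v.
  by apply/colP => j; rewrite mxE ffunE.
rewrite memv_ker lfunE /= /real_mulmx vK; apply/eqP/eqP => [h|->].
  by apply/colP => j; move/ffunP: h => /(_ j); rewrite !ffunE => ->; rewrite mxE.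
by apply/ffunP => j; rewrite !ffunE mxE.
Qed.

End Realification.

Notation posnat := {n : nat | (0 < n)%N}.

Notation multiplicity R := {fsfun (R[i] * posnat)%type -> nat with 0%N}.

Definition jordan_block (F : pzRingType) (a : F) (n : nat) : 'M[F]_n :=
  \matrix_(i, j) (a *+ (i == j) + (i.+1 == j :> nat)%:R).

Section JordanMatrix.
Variables (R : realType) (aleph : multiplicity R).

Definition jordan_blocks : seq (R[i] * posnat) :=
  flatten [seq nseq (aleph x) x | x <- enum_fset (finsupp aleph)].

Let block (i : 'I_(size jordan_blocks)) := tnth (in_tuple jordan_blocks) i.

Definition jordan_dim : nat := (\sum_i val (block i).2)%N.

Definition jordan_mx : 'M[R[i]]_jordan_dim :=
  \mxdiag_i jordan_block (block i).1 (val (block i).2).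

End JordanMatrix.

Section LieAlgebra.
Variables (R : realType) (d : nat) (J : 'M[R[i]]_d).

Definition lie_bracket (x y : 'cV[R[i]]_d * R[i]) : 'cV[R[i]]_d * R[i] :=
  (x.2 *: (J *m y.1) - y.2 *: (J *m x.1), 0).

End LieAlgebra.

(* A subspace on which the bracket vanishes is automatically a subalgebra. *)
Definition almost_abelian (F : fieldType) (L : vectType F) (br : L -> L -> L) :=
  (exists x y : L, br x y <> 0) /\
  (exists2 V : {vspace L}, (\dim V).+1 = \dim (fullv : {vspace L}) &
     {in V &, forall x y, br x y = 0}).

Definition expmx (R : realType) (d : nat) (A : 'M[R[i]]_d) : 'M[R[i]]_d :=
  lim (series (fun n : nat => (n`!%:R)^-1 *: A ^+ n) @ \oo).

(* The pair [(v, t)] stands for [v,t]; [J] is a phantom parameter selecting the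
   group law, while the topology is that of the product C^d x C. *)
Definition aagroup (R : realType) (d : nat) (J : 'M[R[i]]_d) : Type :=
  ('cV[R[i]]_d * R[i])%type.

Section Group.
Variables (R : realType) (d : nat) (J : 'M[R[i]]_d).

Definition aagroup_mul (x y : aagroup J) : aagroup J :=
  (x.1 + expmx (x.2 *: J) *m y.1, x.2 + y.2).

Definition aagroup_one : aagroup J := (0, 0).

Definition aagroup_inv (x : aagroup J) : aagroup J :=
  (- (expmx (- x.2 *: J) *m x.1), - x.2).

HB.instance Definition _ := hasMul.Build (aagroup J) aagroup_mul.
HB.instance Definition _ := hasOne.Build (aagroup J) aagroup_one.
HB.instance Definition _ := hasInv.Build (aagroup J) aagroup_inv.

HB.instance Definition _ :=
  Topological.copy (aagroup J) ('cV[R[i]]_d * R[i])%type.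

Definition realify_aagroup (x : aagroup J) :
    {ffun 'I_d -> Rcomplex R} * Rcomplex R :=
  (realify x.1, x.2).

Definition real_free (k : nat) (g : 'I_k -> aagroup J) : Prop :=
  free [seq realify_aagroup (g i) | i <- enum 'I_k].

End Group.

(* [baseGroupType] carries only the operations, which is all that the notions
   below depend on; the group laws are consequences of the properties of the
   matrix exponential. *)
Section GroupNotions.
Variable G : baseGroupType.
Implicit Types N : set G.

Definition subgroup N : Prop :=
  N 1%g /\ forall x y : G, N x -> N y -> N (x * y^-1)%g.

Definition normal_subgroup N : Prop :=
  subgroup N /\ forall x g : G, N x -> N (conjg x g).

Definition group_center : set G := [set z | forall x : G, commute z x].

Definition generated (k : nat) (g : 'I_k -> G) : set G :=
  smallest subgroup (range g).

Definition free_abelian_of_rank N (k : nat) : Prop :=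
  exists phi : 'rV[int]_k -> G,
    [/\ {morph phi : a b / a + b >-> (a * b)%g}, injective phi
      & range phi = N].

End GroupNotions.

Definition discrete_set (T : topologicalType) (A : set T) : Prop :=
  A `<=` isolated A.

(* Main.v *)
Require Import Defs.
From mathcomp Require Import all_boot all_order all_algebra finmap complex.
From mathcomp Require Import all_classical all_reals all_analysis.
From mathcomp Require Import ring lra.
Import Order.TTheory GRing.Theory Num.Theory.
Import numFieldNormedType.Exports.
Set Implicit Arguments.
Unset Strict Implicit.
Unset Printing Implicit Defensive.
Local Open Scope classical_set_scope.
Local Open Scope ring_scope.

(** Conjugating an element [v,t] of a discrete normal subgroup [N] by elements
    close to the identity cannot move it, which forces [J v = 0] and
    [exp (t J) = 1]; hence [N] is central. On such elements the group law is the
    addition of [C^d x C], so [N] is a discrete additive subgroup of the real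
    vector space [ker J x C], and a discrete subgroup of a real vector space is
    generated over the integers by linearly independent vectors. *)

(** * Discrete subgroups of real vector spaces *)

Section Subgroups.
Variables (V : zmodType) (L : set V).
Hypotheses (L0 : L 0) (LB : forall x y, L x -> L y -> L (x - y)).

Lemma subgroupN x : L x -> L (- x).
Proof. by move=> Lx; rewrite -[- x]add0r; apply: LB. Qed.

Lemma subgroupD x y : L x -> L y -> L (x + y).
Proof. by move=> Lx Ly; rewrite -[y]opprK; apply/LB/subgroupN. Qed.

Lemma subgroup_mulz x (a : int) : L x -> L (x *~ a).
Proof.
move=> Lx; have Ln n : L (x *+ n).
  by elim: n => [|n IHn]; rewrite ?mulr0n // mulrS; apply: subgroupD.
by case: a => n; [exact: Ln | apply/subgroupN/Ln].
Qed.

Lemma subgroup_sum (I : finType) (F : I -> V) :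
  (forall i, L (F i)) -> L (\sum_i F i).
Proof. by move=> LF; apply: big_ind => // *; apply: subgroupD. Qed.

End Subgroups.

(** The gap [d] gives a least positive element: two elements of [C] with the same integer part after
    division by [d] differ by less than [d], hence coincide. Euclidean division by that element does
    the rest. *)
Lemma discrete_subgroup_cyclic (R : archiRealFieldType) (C : set R) (d x0 : R) :
    0 < d -> C 0 -> (forall x y, C x -> C y -> C (x - y)) ->
    (forall x, C x -> `|x| < d -> x = 0) -> C x0 -> x0 != 0 ->
  exists2 c, C c & 0 < c /\ forall x, C x -> exists a : int, x = a%:~R * c.
Proof.
move=> d0 C0 CB Cd Cx0 x0_neq0.
(* Minimising this natural number replaces taking an infimum in [C]. *)
pose P n := `[< exists2 c, C c & 0 < c /\ Num.trunc (c / d) = n >].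
have exP : exists n, P n.
  exists (Num.trunc (`|x0| / d)); apply/asboolP; exists `|x0|.
    by case: (ger0P x0) => _ //; apply: subgroupN.
  by rewrite normr_gt0.
case: (ex_minnP exP) => n /asboolP[c Cc [c0 cn]] n_min.
have c_min x : C x -> 0 < x -> c <= x.
  move=> Cx x_gt0; rewrite leNgt; apply/negP => xc.
  have nx : Num.trunc (x / d) = n.
    apply/eqP; rewrite eqn_leq n_min ?andbT; last by apply/asboolP; exists x.
    by rewrite -cn le_truncn // ler_pM2r ?invr_gt0 // ltW.
  have /truncn_itv : 0 <= x / d by rewrite divr_ge0 // ltW.
  have /truncn_itv : 0 <= c / d by rewrite divr_ge0 // ltW.
  rewrite cn nx !ler_pdivlMr // !ltr_pdivrMr // -natr1 => /andP[_ hc] /andP[hx _].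
  have : c - x = 0.
    by apply: Cd; [exact: CB | rewrite gtr0_norm ?subr_gt0 //; nra].
  by move/eqP; rewrite subr_eq0 => /eqP cx; rewrite cx ltxx in xc.
(* The remainder [x - a%:~R * c] lies in [C] and in the interval from [0] to [c], [c] excluded;
   minimality makes it zero. *)
exists c => //; split=> // x Cx; exists (Num.floor (x / c)).
set a := Num.floor _; have /andP[ha1 ha2] := floor_itv (x / c).
rewrite ler_pdivlMr // in ha1; rewrite ltr_pdivrMr // intrD mulrDl mul1r in ha2.
have Cr : C (x - a%:~R * c).
  by rewrite mulrzl; exact: (CB _ _ Cx (subgroup_mulz C0 CB a Cc)).
apply/eqP; rewrite -subr_eq0; apply: contraT => r_neq0.
have := c_min _ Cr; rewrite lt_def r_neq0 subr_ge0 ha1 => /(_ isT).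
by rewrite leNgt ltrBlDl ha2.
Qed.

(** * Integral bases of discrete subgroups in finite dimension *)

Section Lattice.
Variables (R : realType) (V : vectType R) (L : set V).
Hypotheses (L0 : L 0) (LB : forall x y, L x -> L y -> L (x - y)).
Variables (nu : V -> R) (e : R).
Hypotheses (nu_ge0 : forall x, 0 <= nu x)
  (nuD : forall x y, nu (x + y) <= nu x + nu y)
  (nuZ : forall c x, nu (c *: x) = `|c| * nu x).
Hypotheses (e_gt0 : 0 < e) (Ldiscrete : forall x, L x -> nu x < e -> x = 0).

(** Coefficients are indexed by [nat], so that adding a vector in front only shifts them. *)
Definition zspan (g : seq V) : set V :=
  [set x | exists a : nat -> int, x = \sum_(i < size g) g`_i *~ a i].

Lemma zspan_cons x g y (a : int) : zspan g y -> zspan (x :: g) (x *~ a + y).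
Proof.
move=> [b ->]; exists (fun i => if i is j.+1 then b j else a).
by rewrite big_ord_recl.
Qed.

Lemma nu_sum (I : finType) (F : I -> V) : nu (\sum_i F i) <= \sum_i nu (F i).
Proof.
elim/big_ind2: _ => // [|x a y b xa yb]; last exact: le_trans (nuD _ _) (lerD _ _).
by rewrite -(scale0r 0) nuZ normr0 mul0r.
Qed.

(* Dirichlet's pigeonhole argument: among enough multiples of [c *: x + w],
   reduced modulo the lattice spanned by [g], two are close to each other. *)
Lemma transverse_gap x g :
    free (x :: g) -> (forall i : 'I_(size g), L g`_i) ->
  exists2 d, 0 < d & forall c w, w \in <<g>>%VS -> L (c *: x + w) ->
    `|c| < d -> c = 0.
Proof.
move=> + Lg; rewrite free_cons => /andP[xg _].
(* [S] bounds [nu] on combinations of [x] and [g] with coefficients at most [1] in absolute value;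
   [q] makes [S / q < e], and [M] counts the boxes of side [1 / q] in the unit cube. *)
pose S := nu x + \sum_(i < size g) nu g`_i.
have S0 : 0 <= S by rewrite addr_ge0 // sumr_ge0.
pose q := (Num.trunc (S / e)).+1; pose M := (q ^ size g)%N.
have q0 : 0 < q%:R :> R by rewrite ltr0n.
have Sq : S < e * q%:R.
  rewrite mulrC -ltr_pdivrMr //.
  by case/andP: (truncn_itv (divr_ge0 S0 (ltW e_gt0))).
have M0 : 0 < M%:R :> R by rewrite ltr0n expn_gt0.
(* With this gap, multiplying [c] by an integer of size at most [M] keeps it within [1 / q]. *)
exists (M%:R * q%:R)^-1 => [|c w wg Lcw cd]; first by rewrite invr_gt0 mulr_gt0.
pose u i := coord (in_tuple g) i w.
have wE : w = \sum_i u i *: g`_i by exact: (@coord_span _ _ _ (in_tuple g)).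
pose fr (m : nat) i := m%:R * u i - (Num.floor (m%:R * u i))%:~R.
have fr_ge0 m i : 0 <= fr m i.
  by rewrite /fr subr_ge0; case/andP: (floor_itv (m%:R * u i)).
have fr_lt1 m i : fr m i < 1.
  by rewrite /fr ltrBlDl; case/andP: (floor_itv (m%:R * u i)); rewrite intrD.
have frq_ge0 m i : 0 <= q%:R * fr m i by rewrite mulr_ge0 // ltW.
have fr_trunc m i : (Num.trunc (q%:R * fr m i) < q)%N.
  by rewrite truncn_lt_nat // -[ltRHS]mulr1 ltr_pM2l.
(* [M.+1] multiples fall into [M] boxes, so two of them share a box. *)
pose box (m : 'I_M.+1) := [ffun i : 'I_(size g) => Ordinal (fr_trunc m i)].
have /injectivePn[m [m' mm' eq_box]] : ~~ injectiveb box.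
  apply/negP => /injectiveP/leq_card.
  by rewrite card_ffun !card_ord ltnn.
have close i : `|fr m i - fr m' i| < q%:R^-1.
  move/ffunP: eq_box => /(_ i)/(congr1 val); rewrite !ffunE /= => eq_i.
  have /andP[h1 h2] := truncn_itv (frq_ge0 m i).
  have /andP[h3 h4] := truncn_itv (frq_ge0 m' i).
  rewrite -[ltRHS]natr1 in h2; rewrite -eq_i in h3; rewrite -eq_i -[ltRHS]natr1 in h4.
  rewrite -[ltRHS]mul1r ltr_pdivlMr // mulrC -[q%:R in ltLHS](gtr0_norm q0).
  rewrite -normrM mulrBr.
  by rewrite ltr_norml; apply/andP; split; lra.
(* The difference of the two reduced multiples: it lies in [L] and all its coefficients are at most
   [1 / q], so it vanishes. *)
pose y := (m%:R - m'%:R) * c *: x + \sum_i (fr m i - fr m' i) *: g`_i.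
have yE : y = (c *: x + w) *~ (m%:Z - m'%:Z) -
    \sum_(i < size g) g`_i *~ (Num.floor (m%:R * u i) - Num.floor (m'%:R * u i)).
  rewrite -scaler_int scalerDr scalerA {1}wE scaler_sumr -addrA -sumrB.
  congr (_ *: _ + _); first by rewrite rmorphB.
  apply: eq_bigr => i _; rewrite -[g`_i *~ _]scaler_int scalerA -scalerBl; congr (_ *: _).
  by rewrite !rmorphB /= /fr -!pmulrn; ring.
have Ly : L y.
  rewrite yE; apply: LB; first exact: subgroup_mulz.
  by apply: subgroup_sum => // i; apply: subgroup_mulz.
have cq : `|(m%:R - m'%:R) * c| <= q%:R^-1.
  have mM : `|m%:R - m'%:R| <= M%:R :> R.
    have := ltn_ord m; have := ltn_ord m'; rewrite !ltnS -!(ler_nat R).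
    have := ler0n R m; have := ler0n R m'.
    by move=> *; rewrite ler_norml; apply/andP; split; lra.
  rewrite normrM; apply: le_trans (ler_pM _ _ mM (ltW cd)) _ => //.
  by rewrite invfM mulrA divff ?mul1r // gt_eqF.
have : y = 0.
  apply: Ldiscrete => //; apply: le_lt_trans (nuD _ _) _.
  apply: le_lt_trans (_ : q%:R^-1 * S < _).
    rewrite mulrDr lerD // ?nuZ ?ler_wpM2r //.
    apply: le_trans (nu_sum _) _; rewrite mulr_sumr; apply: ler_sum => i _.
    by rewrite nuZ ler_wpM2r // ltW.
  by rewrite mulrC ltr_pdivrMr.
move=> /eqP; rewrite /y addr_eq0 => /eqP cx.
(* Otherwise [x] would lie in the span of [g]. *)
have : (m%:R - m'%:R) * c = 0.
  apply: contraNeq xg => nz.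
  rewrite -[x](scalerK nz) cx memvZ // memvN memv_suml // => i _.
  by rewrite memvZ // memv_span // mem_nth.
move=> /eqP; rewrite mulf_eq0 subr_eq0 eqr_nat => /orP[|/eqP //].
by rewrite -[_ == _ :> nat]/(m == m') (negPf mm').
Qed.

(** Induction on [b]: the head [x] is replaced by an element of [L] whose [x]-coefficient is the
    smallest positive one, the tail by an integral basis of its span. *)
Lemma lattice_basis_span (b : seq V) :
    free b -> (forall i : 'I_(size b), L b`_i) ->
  exists g : seq V, [/\ size g = size b, <<g>>%VS = <<b>>%VS, free g,
    forall i : 'I_(size g), L g`_i & forall x, x \in <<b>>%VS -> L x -> zspan g x].
Proof.
elim: b => [_ _|x b IHb]; first exists [::].
  split=> [||| [] //|x] //; first exact: nil_free.
  by rewrite span_nil memv0 => /eqP-> _; exists (fun=> 0); rewrite big_ord0.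
rewrite free_cons => /andP[xb fb] Lxb.
have [i|g [sg sp fg Lg zg]] := IHb fb; first exact: (Lxb (lift ord0 i)).
rewrite span_cons -!{}sp in xb zg *.
(* The [x]-coefficients of the elements of [L]; [transverse_gap] makes this subgroup of the reals
   discrete, hence cyclic. *)
pose C := [set c | exists2 w, w \in <<g>>%VS & L (c *: x + w)].
have CB c c' : C c -> C c' -> C (c - c').
  move=> [w wg Lw] [w' wg' Lw']; exists (w - w'); first exact: memvB.
  by rewrite scalerBl addrACA -opprD; exact: LB.
have C0 : C 0 by exists 0; rewrite ?mem0v // scale0r addr0.
have C1 : C 1 by exists 0; rewrite ?mem0v // scale1r addr0; exact: (Lxb ord0).
have [|d d_gt0 gap] := @transverse_gap x g _ Lg; first by rewrite free_cons xb.
have Cd c : C c -> `|c| < d -> c = 0 by case=> w; exact: gap.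
have [c [w wg Lz] [c_gt0 Cc]] :=
  discrete_subgroup_cyclic d_gt0 C0 CB Cd C1 (oner_neq0 _).
pose z := c *: x + w.
have zK : z - w = c *: x by rewrite addrK.
have c_neq0 := lt0r_neq0 c_gt0.
have span_eq : <<z :: g>>%VS = (<[x]> + <<g>>)%VS.
  apply/eqP; rewrite !span_cons eqEsubv !subv_add !addvSr !andbT -!memvE.
  rewrite memv_add ?memvZ ?memv_line //=.
  rewrite -[x in x \in _](scalerK c_neq0).
  rewrite memvZ // -zK memvB //.
    by rewrite (subvP (addvSl _ _)) // memv_line.
  by rewrite (subvP (addvSr _ _)).
exists (z :: g); split.
- by rewrite /= sg.
- exact: span_eq.
- rewrite free_cons fg andbT; apply: contra xb => z_g.
  rewrite -(scalerK c_neq0 x) memvZ // -zK.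
  exact: memvB.
- by case=> -[|i] //= ig; exact: (Lg (Ordinal (ig : (i < size g)%N))).
move=> y /memv_addP[_ /vlineP[k ->] [v vg ->]] Ly.
have [|a ka] := Cc k; first by exists v.
(* Since [k] is [a] times [c], subtracting [z *~ a] cancels the [x]-part and leaves an element of
   [L] in the span of [g]. *)
have -> : k *: x + v = z *~ a + (v - w *~ a).
  by rewrite /z mulrzDl addrACA subrr addr0 ka -scalerA scaler_int.
apply: zspan_cons; apply: zg.
  by rewrite memvB // -scaler_int memvZ.
have -> : v - w *~ a = k *: x + v - z *~ a.
  by rewrite /z mulrzDl ka -scalerA scaler_int opprD addrACA subrr add0r.
by apply: LB => //; apply: subgroup_mulz.
Qed.

(** A free family in [L] of maximal length, bounded by the dimension, spans all of [L] over the
    reals; [lattice_basis_span] makes it integral. *)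
Lemma lattice_basis :
  exists g : seq V, [/\ free g, forall i : 'I_(size g), L g`_i & L `<=` zspan g].
Proof.
pose P n := `[< exists b : seq V,
  [/\ size b = n, free b & forall i : 'I_(size b), L b`_i] >].
have exP : exists n, P n.
  by exists 0; apply/asboolP; exists [::]; split; rewrite ?nil_free // => -[].
have P_le n : P n -> (n <= \dim {:V})%N.
  move=> /asboolP[b [<- fb _]]; rewrite -(eqP (fb : \dim <<b>> == size b)).
  exact/dimvS/subvf.
case: (ex_maxnP exP P_le) => n /asboolP[b [sb fb Lb]] n_max.
have [g [sg span_g fg Lg zg]] := lattice_basis_span fb Lb.
exists g; split=> // x Lx; apply: zg => //; apply: contraT => xb.
have /n_max : P n.+1; last by rewrite ltnn.
apply/asboolP; exists (x :: b); split=> [||].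
- by rewrite /= sb.
- by rewrite free_cons xb.
- by case=> -[|i] //= ib; exact: (Lb (Ordinal (ib : (i < size b)%N))).
Qed.

End Lattice.

Local Open Scope complex_scope.

(** * The matrix exponential *)

Section MxNorm.
Variable R : realType.
Import Normc.

Lemma normcE (z : R[i]) : `|z| = (normc z)%:C.
Proof. by case: z. Qed.

Lemma normc_ge0 (z : R[i]) : 0 <= normc z.
Proof. by case: z => x y; exact: sqrtr_ge0. Qed.

Lemma normc_real (x : R) : normc x%:C = `|x|.
Proof. by rewrite /= expr0n addr0 sqrtr_sqr. Qed.

Lemma normr_Re_le (z : R[i]) : `|complex.Re z| <= normc z.
Proof.
by case: z => x y /=; rewrite -sqrtr_sqr ler_wsqrtr // lerDl sqr_ge0.
Qed.

Lemma normr_Im_le (z : R[i]) : `|complex.Im z| <= normc z.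
Proof.
by case: z => x y /=; rewrite -sqrtr_sqr ler_wsqrtr // lerDr sqr_ge0.
Qed.

Lemma normc_le (z : R[i]) : normc z <= `|complex.Re z| + `|complex.Im z|.
Proof.
case: z => x y; have -> : x +i* y = (x +i* 0) + (0 +i* y) :> R[i].
  by apply/eqP; rewrite eq_complex /= addr0 add0r !eqxx.
apply: le_trans (le_normcD _ _) _.
by rewrite /= expr0n addr0 add0r !sqrtr_sqr addr0 add0r.
Qed.

Lemma normc_sum (I : finType) (F : I -> R[i]) :
  normc (\sum_i F i) <= \sum_i normc (F i).
Proof.
elim/big_ind2: _ => [|x a y b xa yb|//]; first by rewrite normc0.
exact: le_trans (le_normcD _ _) (lerD _ _).
Qed.

(** The entrywise l1 norm, chosen because it is submultiplicative and has values in [R], whereas the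
    norm of [R[i]] is itself complex-valued. *)
Definition mxnorm m n (A : 'M[R[i]]_(m, n)) : R := \sum_i \sum_j normc (A i j).

Lemma mxnorm_ge0 m n (A : 'M[R[i]]_(m, n)) : 0 <= mxnorm A.
Proof. by apply: sumr_ge0 => i _; apply: sumr_ge0 => j _; exact: normc_ge0. Qed.

Lemma le_mxnorm m n (A : 'M[R[i]]_(m, n)) i j : normc (A i j) <= mxnorm A.
Proof.
have le_sum p (F : 'I_p -> R) k : (forall l, 0 <= F l) -> F k <= \sum_l F l.
  by move=> F0; rewrite (bigD1 k) //= lerDl sumr_ge0.
apply: le_trans (le_sum _ (fun i => \sum_j normc (A i j)) i _) => [|k].
  by apply: (le_sum _ (fun j => normc (A i j))) => l; exact: normc_ge0.
by apply: sumr_ge0 => l _; exact: normc_ge0.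
Qed.

Lemma mxnorm_eq0 m n (A : 'M[R[i]]_(m, n)) : mxnorm A = 0 -> A = 0.
Proof.
move=> A0; apply/matrixP => i j; rewrite mxE; apply: eq0_normc; apply/le_anti.
by rewrite normc_ge0 andbT -A0 le_mxnorm.
Qed.

Lemma mxnormD m n (A B : 'M[R[i]]_(m, n)) : mxnorm (A + B) <= mxnorm A + mxnorm B.
Proof.
rewrite -big_split; apply: ler_sum => i _; rewrite -big_split.
by apply: ler_sum => j _; rewrite mxE; exact: le_normcD.
Qed.

Lemma mxnormZ m n c (A : 'M[R[i]]_(m, n)) : mxnorm (c *: A) = normc c * mxnorm A.
Proof.
rewrite /mxnorm mulr_sumr; apply: eq_bigr => i _; rewrite mulr_sumr.
by apply: eq_bigr => j _; rewrite mxE normcM.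
Qed.

Lemma mxnorm0 m n : mxnorm (0 : 'M[R[i]]_(m, n)) = 0.
Proof. by rewrite -(scale0r 0) mxnormZ normc0 mul0r. Qed.

Lemma mxnormN m n (A : 'M[R[i]]_(m, n)) : mxnorm (- A) = mxnorm A.
Proof. by rewrite -scaleN1r mxnormZ normcN normc1 mul1r. Qed.

Lemma mxnorm_sum m n (I : Type) (r : seq I) (P : pred I) (F : I -> 'M[R[i]]_(m, n)) :
  mxnorm (\sum_(i <- r | P i) F i) <= \sum_(i <- r | P i) mxnorm (F i).
Proof.
elim/big_ind2: _ => [|x a y b xa yb|//]; first by rewrite mxnorm0.
exact: le_trans (mxnormD _ _) (lerD _ _).
Qed.

Lemma mxnormM m n p (A : 'M[R[i]]_(m, n)) (B : 'M[R[i]]_(n, p)) :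
  mxnorm (A *m B) <= mxnorm A * mxnorm B.
Proof.
rewrite {2}/mxnorm mulr_suml; apply: ler_sum => i _.
rewrite mulr_suml.
apply: (@le_trans _ _ (\sum_j \sum_k normc (A i k) * normc (B k j))).
  apply: ler_sum => j _; rewrite mxE; apply: le_trans (normc_sum _) _.
  by apply: ler_sum => k _; rewrite normcM.
rewrite exchange_big /=; apply: ler_sum => k _; rewrite -mulr_sumr.
apply: ler_wpM2l; first exact: normc_ge0.
rewrite /mxnorm [leRHS](bigD1 k) //= lerDl sumr_ge0 // => l _.
by apply: sumr_ge0 => j _; exact: normc_ge0.
Qed.

(** Exponent [0] is excluded: the identity has norm [d], which may exceed [1]. *)
Lemma mxnormX d (A : 'M[R[i]]_d) k : mxnorm (A ^+ k.+1) <= mxnorm A ^+ k.+1.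
Proof.
elim: k => [|k IHk]; first by rewrite !expr1.
rewrite [A ^+ _]exprS [mxnorm A ^+ _]exprS; apply: le_trans (mxnormM _ _) _.
by apply: ler_wpM2l; first exact: mxnorm_ge0.
Qed.

(** * Convergence of the exponential series and estimates on its sum *)

Section Expmx.
Variables (d : nat) (A : 'M[R[i]]_d).
Let u k : 'M[R[i]]_d := (k`!%:R)^-1 *: A ^+ k.

Lemma normc_natV k : normc ((k%:R)^-1 : R[i]) = (k%:R)^-1.
Proof. by rewrite normcV -(rmorph_nat (real_complex R)) normc_real ger0_norm. Qed.

(** Bounding entries rather than the norm covers [k = 0] too, as the identity has entries [0] and
    [1]. *)
Lemma normc_expmx_term k i j : normc (u k i j) <= exp_coeff (mxnorm A) k.
Proof.
rewrite mxE normcM normc_natV /exp_coeff /= mulrC ler_wpM2r ?invr_ge0 //.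
case: k => [|k]; last exact: le_trans (le_mxnorm _ _ _) (mxnormX _ _).
by rewrite !expr0 mxE; case: (i == j); rewrite ?normc1 ?normc0.
Qed.

(** Meant for [f] the real or imaginary part: domination by the real exponential series gives
    absolute convergence. *)
Lemma is_cvg_expmx_part (f : R[i] -> R) i j :
  (forall z, `|f z| <= normc z) -> cvgn (series (fun k => f (u k i j))).
Proof.
move=> f_le; apply: normed_cvg.
apply: (@series_le_cvg _ _ (exp_coeff (mxnorm A))) => [k|k|k|].
- exact: normr_ge0.
- exact/exp_coeff_ge0/mxnorm_ge0.
- exact: le_trans (f_le _) (normc_expmx_term _ _ _).
- exact: is_cvg_series_exp_coeff.
Qed.

Lemma cvg_sum0 (I : Type) (r : seq I) (F : I -> nat -> R) :
    (forall i, F i @ \oo --> 0) ->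
  (fun n => \sum_(i <- r) F i n) @ \oo --> 0.
Proof.
move=> F0; elim: r => [|i r IHr].
  rewrite (_ : (fun _ => _) = cst 0); first exact: cvg_cst.
  by apply/funext => n; rewrite big_nil.
rewrite (_ : (fun _ => _) = F i \+ (fun n => \sum_(j <- r) F j n)).
  by rewrite -[X in _ --> X]addr0; apply: cvgD.
by apply/funext => n; rewrite big_cons.
Qed.

(** [expmx] is a bare [lim], meaningful only once a limit is exhibited: [E] is assembled from the
    limits of real and imaginary parts, then identified with [expmx A]. *)
Lemma expmx_cvg : (fun n => mxnorm (expmx A - series u n)) @ \oo --> (0 : R).
Proof.
pose part (f : R[i] -> R) i j := limn (series (fun k => f (u k i j))).
pose E : 'M[R[i]]_d :=
  \matrix_(i, j) (part (@complex.Re R) i j +i* part (@complex.Im R) i j).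
have part_cvg f i j : (forall z, `|f z| <= normc z) ->
    (fun n => `|part f i j - series (fun k => f (u k i j)) n|) @ \oo --> (0 : R).
  move=> /(@is_cvg_expmx_part _ i j) cf; rewrite -(normr0 R) -(subrr (part f i j)).
  by apply: cvg_norm; apply: cvgB; [exact: cvg_cst | exact: cf].
have E_cvg : (fun n => mxnorm (E - series u n)) @ \oo --> (0 : R).
  apply: (@squeeze_cvgr _ _ _ _ (cst 0) (fun n => \sum_i \sum_j
      (`|part (@complex.Re R) i j - series (fun k => complex.Re (u k i j)) n| +
       `|part (@complex.Im R) i j - series (fun k => complex.Im (u k i j)) n|))).
  - near=> n; rewrite mxnorm_ge0; apply: ler_sum => i _; apply: ler_sum => j _.
    apply: le_trans (normc_le _) _; rewrite !mxE summxE.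
    have ReD : {morph (@complex.Re R) : x y / x + y} by move=> [? ?] [? ?].
    have ImD : {morph (@complex.Im R) : x y / x + y} by move=> [? ?] [? ?].
    have ReN : {morph (@complex.Re R) : x / - x} by move=> [? ?].
    have ImN : {morph (@complex.Im R) : x / - x} by move=> [? ?].
    rewrite ReD ImD ReN ImN /series /=.
    by rewrite (big_morph _ ReD erefl) (big_morph _ ImD erefl).
  - exact: cvg_cst.
  - apply: cvg_sum0 => i; apply: cvg_sum0 => j.
    rewrite -[X in _ --> X]addr0.
    by apply: cvgD; apply: part_cvg => z; [exact: normr_Re_le | exact: normr_Im_le].
suff -> : expmx A = E by [].
apply: cvg_lim; first exact: norm_hausdorff.
(* Radii are complex here; positivity forces the imaginary part to vanish. *)
apply/cvg_ballP => -[e e'] /[dup]; rewrite {1}ltcE /= => /andP[/eqP -> e0] e0'.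
move/cvgrPdist_lt: E_cvg => /(_ e e0); apply: filterS => n.
rewrite sub0r normrN ger0_norm ?mxnorm_ge0 // => Ee; split=> // i j.
rewrite -ball_normE /= normcE ltcR; apply: le_lt_trans Ee.
by have := le_mxnorm (E - series u n) i j; rewrite !mxE.
Unshelve. all: by end_near.
Qed.

(** Passage to the limit in a closed inequality. Partial sums start at [n.+2] so that the terms
    [1%:M] and [A] can be split off. *)
Lemma mxnorm_expmx_le m (X Y : 'M[R[i]]_(d, m)) b :
  (forall n, mxnorm (series u n.+2 *m X - Y) <= b) -> mxnorm (expmx A *m X - Y) <= b.
Proof.
move=> Sb; apply/ler_addgt0Pr => e e0.
(* The added [1] keeps the denominator positive when [X] is zero. *)
have eX0 : 0 < e / (mxnorm X + 1) by rewrite divr_gt0 // ltr_wpDl ?mxnorm_ge0.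
have [n _ /(_ n.+2)] := (cvgrPdist_lt _ _).1 expmx_cvg _ eX0.
rewrite sub0r normrN ger0_norm ?mxnorm_ge0 //= => /(_ (leqW (leqnSn n))) En.
have -> : expmx A *m X - Y = (expmx A - series u n.+2) *m X + (series u n.+2 *m X - Y).
  by rewrite mulmxBl addrA subrK.
apply: le_trans (mxnormD _ _) _; rewrite addrC lerD //.
apply: le_trans (mxnormM _ _) _.
apply: le_trans (ler_wpM2r (mxnorm_ge0 _) (ltW En)) _.
rewrite -mulrA ler_piMr ?(ltW e0) // mulrC ler_pdivrMr ?mul1r ?lerDl //.
by rewrite ltr_wpDl ?mxnorm_ge0.
Qed.

Lemma series_expmx n : series u n.+2 = 1%:M + A + \sum_(k < n) u k.+2.
Proof.
rewrite /series /= big_mkord !big_ord_recl addrA /u expr0 expr1 fact0 !invr1.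
by rewrite !scale1r.
Qed.

Lemma expmx_fixed m (X : 'M[R[i]]_(d, m)) : A *m X = 0 -> expmx A *m X = X.
Proof.
move=> AX; apply/eqP; rewrite -subr_eq0; apply/eqP/mxnorm_eq0/le_anti.
rewrite mxnorm_ge0 andbT; apply: mxnorm_expmx_le => n.
rewrite series_expmx !mulmxDl mul1mx AX addr0 mulmx_suml big1 ?addr0 => [|k _].
  by rewrite subrr mxnorm0.
by rewrite -scalemxAl exprSr -mulmxA AX mulmx0 scaler0.
Qed.

End Expmx.

Lemma expmx0 d : expmx (0 : 'M[R[i]]_d) = 1%:M.
Proof. by rewrite -[LHS]mulmx1 expmx_fixed // mul0mx. Qed.

(** For [normc s <= 1], each term of order at least two contains a factor at most [normc s ^+ 2];
    what remains is a tail of the series of [expR (mxnorm A)]. *)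
Lemma expmx_quadratic d (A : 'M[R[i]]_d) s : normc s <= 1 ->
  mxnorm (expmx (s *: A) - (1%:M + s *: A)) <= expR (mxnorm A) * normc s ^+ 2.
Proof.
move=> s1; have s0 := normc_ge0 s; rewrite -[expmx _]mulmx1.
apply: mxnorm_expmx_le => n; rewrite series_expmx mulmx1 addrC addKr.
apply: le_trans (mxnorm_sum _ _ _) _.
apply: (@le_trans _ _ (\sum_(k < n) exp_coeff (mxnorm A) k.+2 * normc s ^+ 2)).
  apply: ler_sum => k _.
  rewrite mxnormZ normc_natV mulrC /exp_coeff /= mulrAC.
  rewrite ler_wpM2r ?invr_ge0 //; apply: le_trans (mxnormX _ _) _.
  rewrite mxnormZ exprMn mulrC ler_wpM2l ?exprn_ge0 ?mxnorm_ge0 //.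
  by rewrite -addn2 exprD ler_piMl ?exprn_ge0 ?exprn_ile1.
rewrite -mulr_suml ler_wpM2r ?exprn_ge0 //.
apply: (@le_trans _ _ (series (exp_coeff (mxnorm A)) n.+2)).
  rewrite /series /= big_mkord !big_ord_recl.
  by rewrite addrA lerDr addr_ge0 // exp_coeff_ge0 ?mxnorm_ge0.
apply: nondecreasing_cvgn_le; last exact: is_cvg_series_exp_coeff.
apply: nondecreasing_series => k _ _; exact/exp_coeff_ge0/mxnorm_ge0.
Qed.

End MxNorm.

(** * Discrete normal subgroups are central *)

Lemma small_scale (R : realFieldType) (a b e m : R) :
    0 <= a -> 0 <= b -> 0 < e -> 0 < m ->
  exists t, [/\ 0 < t, t <= 1, t * a < e & t * b < m].
Proof.
move=> a0 b0 e0 m0; have a1 : 0 < a + 1 by rewrite ltr_wpDl.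
have b1 : 0 < b + 1 by rewrite ltr_wpDl.
exists (Num.min 1 (Num.min (e / (a + 1)) (m / (b + 1)))); split.
- by rewrite !lt_min ltr01 !divr_gt0.
- by rewrite ge_min lexx.
- apply: (@le_lt_trans _ _ (e / (a + 1) * a)).
    by rewrite ler_wpM2r // !ge_min lexx orbT.
  by rewrite mulrAC ltr_pdivrMr // mulrDr mulr1 ltrDl.
- apply: (@le_lt_trans _ _ (m / (b + 1) * b)).
    by rewrite ler_wpM2r // !ge_min lexx !orbT.
  by rewrite mulrAC ltr_pdivrMr // mulrDr mulr1 ltrDl.
Qed.

Section DiscreteNormal.
Variables (R : realType) (d : nat) (J : 'M[R[i]]_d).
Import Normc.

Lemma aagroup_conjgE (x : aagroup J) u s :
  conjg x ((u, s) : aagroup J) =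
  (expmx (- s *: J) *m (x.1 + expmx (x.2 *: J) *m u - u), x.2).
Proof.
rewrite /conjg /mul /= /aagroup_mul /=; congr (_, _); last by rewrite addrC addrK.
by rewrite mulmxBr addrC.
Qed.

Lemma aagroup_conjg_time (x : aagroup J) s :
  conjg x ((0, s) : aagroup J) = (expmx (- s *: J) *m x.1, x.2).
Proof.
rewrite aagroup_conjgE; congr (_ *m _, _).
by move: (expmx _) => E; rewrite mulmx0 addr0 subr0.
Qed.

Lemma aagroup_conjg_space (x : aagroup J) u :
  conjg x ((u, 0) : aagroup J) = (x.1 + (expmx (x.2 *: J) *m u - u), x.2).
Proof.
rewrite aagroup_conjgE; congr (_, _).
by rewrite oppr0 scale0r expmx0 mul1mx addrA.
Qed.

(** Ensures that conjugation by [(0, s)] moves a point by only [O(s)]. *)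
Lemma expmx_lipschitz : exists2 C, 0 <= C &
  forall s, normc s <= 1 -> mxnorm (expmx (s *: J) - 1%:M) <= C * normc s.
Proof.
exists (expR (mxnorm J) + mxnorm J); first by rewrite addr_ge0 ?expR_ge0 ?mxnorm_ge0.
move=> s s1; have s0 := normc_ge0 s.
have -> : expmx (s *: J) - 1%:M = (expmx (s *: J) - (1%:M + s *: J)) + s *: J.
  by rewrite opprD addrA subrK.
apply: le_trans (mxnormD _ _) _; rewrite mulrDl mxnormZ [normc s * _]mulrC lerD2r.
apply: le_trans (expmx_quadratic _ s1) _.
by rewrite ler_wpM2l ?expR_ge0 // ler_piMr.
Qed.

Definition central_elt (x : aagroup J) := J *m x.1 = 0 /\ expmx (x.2 *: J) = 1%:M.

(** The exponential fixes [ker J] pointwise, so the twist in the group law disappears. *)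
Lemma aagroup_mul_ker (x y : aagroup J) : J *m y.1 = 0 ->
  (x * y)%g = (x.1 + y.1, x.2 + y.2) :> aagroup J.
Proof.
by move=> Jy; rewrite -[(x * y)%g]/(aagroup_mul x y) /aagroup_mul;
  rewrite expmx_fixed // -scalemxAl Jy scaler0.
Qed.

Lemma aagroup_inv_ker (y : aagroup J) : J *m y.1 = 0 ->
  y^-1%g = (- y.1, - y.2) :> aagroup J.
Proof.
by move=> Jy; rewrite -[y^-1%g]/(aagroup_inv y) /aagroup_inv;
  rewrite expmx_fixed // -scalemxAl Jy scaler0.
Qed.

Lemma central_elt_center (x : aagroup J) : central_elt x -> group_center x.
Proof.
move=> [Jx Ex] y; rewrite /commute (aagroup_mul_ker y Jx).
by rewrite -[(x * y)%g]/(aagroup_mul x y) /aagroup_mul Ex mul1mx addrC [x.2 + _]addrC.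
Qed.

Variable N : set (aagroup J).
Hypotheses (N_normal : normal_subgroup N) (N_discrete : discrete_set N).

Lemma discrete_gap x : N x -> exists2 e : R, 0 < e & forall y, N y ->
  mxnorm (y.1 - x.1) < e -> normc (y.2 - x.2) < e -> y = x.
Proof.
move=> Nx; have [_ [V Vx VN]] := N_discrete Nx.
have /nbhs_ballP[[e e'] /=] : nbhs (x : 'cV[R[i]]_d * R[i]) V := Vx.
(* The complex radius, being positive, is a real number. *)
rewrite ltcE /= => /andP[/eqP-> e0] xV; exists e => // y Ny y1 y2.
suff Vy : V y by have : [set x] y by rewrite -VN.
apply: xV; split.
  split=> [|i j]; first by rewrite ltcR.
  rewrite -ball_normE /= distrC normcE ltcR; apply: le_lt_trans y1.
  by have := le_mxnorm (y.1 - x.1) i j; rewrite !mxE.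
by rewrite -ball_normE /= distrC normcE ltcR.
Qed.

(* Conjugating [x] by a small [(0, s)] or [(u, 0)] moves it so little that it
   stays fixed; letting [s] tend to [0], respectively by linearity in [u], this
   yields the two equations defining the center. *)
Lemma discrete_normal_central x : N x -> central_elt x.
Proof.
move=> Nx; have [e e0 gap] := discrete_gap Nx.
have fixed_by g : mxnorm ((conjg x g).1 - x.1) < e -> (conjg x g).1 = x.1.
  move=> ge; rewrite (gap (conjg x g)) //; first exact: N_normal.2.
  by case: g {ge} => u s; rewrite aagroup_conjgE subrr normc0.
have fixed_time s : mxnorm (expmx (s *: J) *m x.1 - x.1) < e ->
    expmx (s *: J) *m x.1 = x.1.
  by have := fixed_by (0, - s); rewrite aagroup_conjg_time opprK.
have fixed_space (u : 'cV[R[i]]_d) : mxnorm (expmx (x.2 *: J) *m u - u) < e ->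
    expmx (x.2 *: J) *m u - u = 0.
  have := fixed_by (u, 0); rewrite aagroup_conjg_space.
  move: (_ *m u - u) => w /= h wd; apply: (addrI x.1).
  by rewrite addr0 h // addrAC subrr add0r.
split.
  have [C C0 lip] := expmx_lipschitz.
  apply/mxnorm_eq0/eqP; apply: contraT; rewrite neq_lt ltNge mxnorm_ge0 /=.
  move=> Jx0; pose K := expR (mxnorm J) * mxnorm x.1.
  have K0 : 0 <= K by rewrite mulr_ge0 ?expR_ge0 ?mxnorm_ge0.
  have Cx0 : 0 <= C * mxnorm x.1 by rewrite mulr_ge0 ?mxnorm_ge0.
  (* [tC] makes conjugation by time [t] fix [x]; then [t J x.1] equals, up to sign, the second-order
     remainder, of norm at most [t * (t * K)], which contradicts [tK]. *)
  have [t [t0 t1 tC tK]] := small_scale Cx0 K0 e0 Jx0.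
  have nt : normc t%:C = t by rewrite normc_real gtr0_norm.
  have Efix : expmx (t%:C *: J) *m x.1 = x.1.
    apply: fixed_time; rewrite -{2}[x.1]mul1mx -mulmxBl.
    apply: le_lt_trans (mxnormM _ _) _; apply: le_lt_trans tC.
    rewrite mulrCA mulrA ler_wpM2r ?mxnorm_ge0 //.
    by have := lip t%:C; rewrite nt => /(_ t1).
  have : mxnorm (t%:C *: (J *m x.1)) <= t * (t * K).
    rewrite -mxnormN.
    have -> : - (t%:C *: (J *m x.1)) = (expmx (t%:C *: J) - (1%:M + t%:C *: J)) *m x.1.
      by rewrite mulmxBl Efix mulmxDl mul1mx opprD addrA subrr add0r -scalemxAl.
    apply: le_trans (mxnormM _ _) _.
    rewrite mulrA -expr2 mulrA [_ ^+ 2 * _]mulrC ler_wpM2r ?mxnorm_ge0 //.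
    by have := @expmx_quadratic _ _ J t%:C; rewrite nt => /(_ t1).
  by rewrite mxnormZ nt ler_pM2l // leNgt tK.
have Eu (u : 'cV[R[i]]_d) : expmx (x.2 *: J) *m u = u.
  set y := expmx (x.2 *: J) *m u - u.
  (* Only the first smallness condition matters; the second is filled with [0 < 1]. The displacement
     is linear in [u], so fixing [t u] fixes [u]. *)
  have [t [t0 _ ty _]] := small_scale (mxnorm_ge0 y) (lexx 0) e0 ltr01.
  have := fixed_space (t%:C *: u).
  rewrite -scalemxAr -scalerBr mxnormZ.
  rewrite normc_real gtr0_norm // => /(_ ty)/eqP.
  rewrite scaler_eq0 subr_eq0 => /orP[|/eqP //].
  by rewrite eq_complex /= gt_eqF.
apply/matrixP => i j; have /colP/(_ i) := Eu (delta_mx j 0).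
by rewrite -colE !mxE eqxx andbT.
Qed.

End DiscreteNormal.

(** * Reduction to a discrete subgroup of [ker J x C] *)

(** Rank-nullity for the first projection on [X]: its image lies in [K], and the second projection
    is injective on its kernel. *)
Lemma dimv_prod_le (F : fieldType) (U W : vectType F) (K : {vspace U})
    (X : {vspace (U * W)%type}) :
  {in X, forall x, x.1 \in K} -> (\dim X <= \dim K + \dim {:W})%N.
Proof.
move=> XK; pose p1 : 'Hom((U * W)%type, U) := linfun fst.
pose p2 : 'Hom((U * W)%type, W) := linfun snd.
rewrite -(limg_ker_dim p1 X) addnC leq_add //.
  apply: dimvS; apply/subvP => _ /memv_imgP[x xX ->].
  by rewrite lfunE /=; exact: XK.
rewrite -(limg_dim_eq (f := p2)); first exact/dimvS/subvf.
apply/eqP; rewrite -subv0; apply/subvP => -[u w].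
by rewrite !memv_cap !memv_ker !lfunE /= memv0 => /andP[/andP[_ /eqP->] /eqP->].
Qed.

Lemma free_zcomb_inj (R : realType) (V : vectType R) (g : seq V)
    (a b : 'I_(size g) -> int) :
  free g -> \sum_(i < size g) g`_i *~ a i = \sum_(i < size g) g`_i *~ b i -> a =1 b.
Proof.
move=> /(@freeP _ _ _ (in_tuple g)) fg ab i; apply/eqP.
rewrite -subr_eq0 -(intr_eq0 R); apply/eqP; move: i.
apply: fg; apply/eqP; rewrite -subr_eq0 subr0.
under eq_bigr do rewrite scaler_int mulrzBr.
by rewrite sumrB ab subrr.
Qed.

Section Realification.
Variables (R : realType) (d : nat) (J : 'M[R[i]]_d).
Import Normc.
Local Notation V := ({ffun 'I_d -> Rcomplex R} * Rcomplex R)%type.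

Definition complexify_aagroup (w : V) : aagroup J := (unrealify w.1, w.2).

Lemma realify_aagroupK : cancel (@realify_aagroup R d J) complexify_aagroup.
Proof. by case=> v t; congr (_, _); apply/colP => i; rewrite mxE ffunE. Qed.

Lemma complexify_aagroupK : cancel complexify_aagroup (@realify_aagroup R d J).
Proof. by case=> v t; congr (_, _); apply/ffunP => i; rewrite ffunE mxE. Qed.

Lemma unrealifyD (v w : {ffun 'I_d -> Rcomplex R}) :
  unrealify (v + w) = unrealify v + unrealify w.
Proof. by apply/colP => i; rewrite !mxE ffunE. Qed.

Lemma unrealifyN (v : {ffun 'I_d -> Rcomplex R}) :
  unrealify (- v) = - unrealify v.
Proof. by apply/colP => i; rewrite !mxE ffunE. Qed.

Lemma unrealifyZ (c : R) (v : {ffun 'I_d -> Rcomplex R}) :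
  unrealify (c *: v) = c%:C *: unrealify v.
Proof.
apply/colP => i; rewrite !mxE ffunE; case: (v i) => x y.
by apply/eqP; rewrite eq_complex /= !mul0r subr0 addr0 !eqxx.
Qed.

Definition real_norm (w : V) : R := mxnorm (unrealify w.1) + normc w.2.

Lemma real_norm_ge0 w : 0 <= real_norm w.
Proof. by rewrite addr_ge0 ?mxnorm_ge0 ?normc_ge0. Qed.

Lemma real_normD w w' : real_norm (w + w') <= real_norm w + real_norm w'.
Proof.
by rewrite /real_norm /= unrealifyD addrACA lerD ?mxnormD ?le_normcD.
Qed.

Lemma real_normZ c w : real_norm (c *: w) = `|c| * real_norm w.
Proof.
rewrite /real_norm /= unrealifyZ mxnormZ normc_real mulrDr; congr (_ + _).
rewrite -normc_real -normcM; congr normc; case: w.2 => x y.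
by apply/eqP; rewrite eq_complex /= !mul0r subr0 addr0 !eqxx.
Qed.

End Realification.

Lemma discrete_normal_lattice (R : realType) (d : nat) (J : 'M[R[i]]_d)
    (N : set (aagroup J)) (N_normal : normal_subgroup N)
    (N_discrete : discrete_set N) :
  exists (k : nat) (g : 'I_k -> aagroup J),
    [/\ (k <= \dim (real_ker J) + 2)%N,
        free_abelian_of_rank N k,
        N = generated g,
        real_free g
      & forall i, group_center (g i)].
Proof.
pose V := ({ffun 'I_d -> Rcomplex R} * Rcomplex R)%type.
pose c : V -> aagroup J := @complexify_aagroup R d J.
pose L : set V := [set w | N (c w)].
have Nc x : N x -> central_elt x by exact: discrete_normal_central.
have c00 : c 0 = (0, 0) by congr (_, _); apply/colP => i; rewrite !mxE ffunE.
have c0 : c 0 = 1%g by exact: c00.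
have LJ w : L w -> J *m (c w).1 = 0 by case/Nc.
have LNJ w : L w -> J *m (c (- w)).1 = 0.
  by move=> /LJ; rewrite /c /= unrealifyN mulmxN => ->; rewrite oppr0.
have cN w : L w -> c (- w) = (c w)^-1%g.
  by move=> /LJ/aagroup_inv_ker ->; rewrite /c /complexify_aagroup /= unrealifyN.
(* Hence [c] restricted to [L] turns addition into the group law of [N]. *)
have cD w w' : J *m (c w').1 = 0 -> c (w + w') = (c w * c w')%g.
  by move=> /(aagroup_mul_ker (c w)) ->; rewrite /c /complexify_aagroup /= unrealifyD.
have L0 : L 0 by rewrite /L /= c0; exact: N_normal.1.1.
have LB w w' : L w -> L w' -> L (w - w').
  move=> Lw Lw'; rewrite /L /= (cD _ _ (LNJ _ Lw')) (cN _ Lw').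
  exact: N_normal.1.2.
have [e e0 gap] := discrete_gap N_discrete L0.
have Ldisc w : L w -> real_norm w < e -> w = 0.
  move=> Lw; rewrite /real_norm => we.
  rewrite -[w](complexify_aagroupK J) -[0](complexify_aagroupK J).
  congr realify_aagroup; apply: gap => //; rewrite c00 subr0.
    by apply: le_lt_trans we; rewrite lerDl normc_ge0.
  by apply: le_lt_trans we; rewrite lerDr mxnorm_ge0.
have [g [fg Lg zg]] := lattice_basis L0 LB (@real_norm_ge0 R d) (@real_normD R d)
  (@real_normZ R d) e0 Ldisc.
have Lsum (a : 'I_(size g) -> int) : L (\sum_(i < size g) g`_i *~ a i).
  by apply: subgroup_sum => // i; apply: subgroup_mulz.
pose G (i : 'I_(size g)) := c g`_i.
have GS (S : set (aagroup J)) : subgroup S -> range G `<=` S -> N `<=` S.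
  move=> [S1 SB] GS x Nx; have [|a xE] := zg (realify_aagroup x).
    by rewrite /L /= /c realify_aagroupK.
  (* The preimage of [S] is cut down to [L], where [c] is multiplicative, so that it is an additive
     subgroup. *)
  pose LS := [set w | L w /\ S (c w)].
  suff : LS (realify_aagroup x) by move=> []; rewrite /c realify_aagroupK.
  have LS0 : LS 0 by split; rewrite // c0.
  have LSB w w' : LS w -> LS w' -> LS (w - w').
    move=> [Lw Sw] [Lw' Sw']; split; first exact: LB.
    by rewrite (cD _ _ (LNJ _ Lw')) (cN _ Lw'); exact: SB.
  rewrite xE; apply: (subgroup_sum LS0 LSB) => i; apply: (subgroup_mulz LS0 LSB).
  by split; [exact: Lg | apply: GS; exists i].
exists (size g), G; split.
(* The rank is the real dimension of the span of [g], which lies in [ker J] times the complex line;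
   that line contributes the [2]. *)
- rewrite -(eqP (fg : \dim <<g>>%VS == size g)).
  have <- : \dim {:Rcomplex R} = 2%N by rewrite dimvf.
  apply: dimv_prod_le => x xg.
  pose p := linfun (@fst {ffun 'I_d -> Rcomplex R} (Rcomplex R)).
  suff : (<<g>> <= p @^-1: real_ker J)%VS.
    by move=> /subvP/(_ x xg); rewrite -memv_preim lfunE.
  apply/span_subvP => _ /(nthP 0)[i ig <-]; rewrite -memv_preim lfunE /=.
  have -> : (g`_i).1 = realify (c g`_i).1 by apply/ffunP => j; rewrite ffunE mxE.
  by rewrite mem_real_ker; apply/eqP/LJ/(Lg (Ordinal ig)).
- exists (fun a => c (\sum_(i < size g) g`_i *~ a 0 i)); split.
  + move=> a b; rewrite -cD; last exact: LJ.
    congr c; rewrite -big_split; apply: eq_bigr => i _.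
    by rewrite mxE mulrzDr.
  (* Freeness over the reals makes the integer coefficients unique. *)
  + move=> a b /(can_inj (complexify_aagroupK J)) ab; apply/rowP => i.
    exact: free_zcomb_inj fg ab i.
  + apply/seteqP; split=> [_ [a _ <-]|]; first exact: Lsum.
    move=> x Nx; have [|a xE] := zg (realify_aagroup x).
      by rewrite /L /= /c realify_aagroupK.
    exists (\row_i a i) => //; under eq_bigr do rewrite mxE.
    by rewrite -xE /c realify_aagroupK.
- apply/seteqP; split.
    by move=> x Nx S [subS GS']; exact: GS subS GS' x Nx.
  apply: smallest_sub; first exact: N_normal.1.
  by move=> _ [i _ <-]; exact: Lg.
- rewrite /real_free.
  suff -> : [seq realify_aagroup (G i) | i <- enum 'I_(size g)] = g by [].
  have sz : size (enum 'I_(size g)) = size g by exact: size_enum_ord.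
  apply: (@eq_from_nth _ 0); rewrite size_map sz // => i ig.
  rewrite (nth_map (Ordinal ig)) ?sz // /G /c complexify_aagroupK.
  by rewrite nth_enum_ord.
- by move=> i; apply/central_elt_center/Nc/Lg.
Qed.

Local Close Scope complex_scope.

Theorem proposition5p2 (R : realType) (aleph : multiplicity R)
    (aleph_aa : almost_abelian (lie_bracket (jordan_mx aleph)))
    (N : set (aagroup (jordan_mx aleph)))
    (N_normal : normal_subgroup N) (N_discrete : discrete_set N) :
  exists (k : nat) (g : 'I_k -> aagroup (jordan_mx aleph)),
    [/\ (k <= \dim (real_ker (jordan_mx aleph)) + 2)%N,
        free_abelian_of_rank N k,
        N = generated g,
        real_free g
      & forall i, group_center (g i)].
Proof. exact: discrete_normal_lattice. Qed.
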